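(* Let $\mathcal{D}_{\mathrm{cal}}=\{(\boldsymbol{X}_n,\boldsymbol{y}_n)\}_{n=1}^{N_2}$ be the calibration dataset, and let $(\boldsymbol{X}_{N_2+1},\boldsymbol{y}_{N_2+1})$ be a new sample from the same distribution, such that the $N_2+1$ samples $(\boldsymbol{X}_1,\boldsymbol{y}_1),\dots,(\boldsymbol{X}_{N_2+1},\boldsymbol{y}_{N_2+1})$ are exchangeable. Let $\epsilon\in(0,1)$ be the risk tolerance, and let $\hat{\mathcal{U}}_{\mathrm{box}}(\boldsymbol{X}_{N_2+1})$ and $\hat{\mathcal{U}}_{\mathrm{ell}}(\boldsymbol{X}_{N_2+1})$ be the calibrated box and ellipsoidal uncertainty sets produced by the calibration procedures from $\mathcal{D}_{\mathrm{cal}}$ and $\epsilon$. Then, for each $e\in\{\mathrm{box},\mathrm{ell}\}$, $$\mathbb{P}\left(\boldsymbol{y}_{N_2+1}\in\hat{\mathcal{U}}_{e}(\boldsymbol{X}_{N_2+1})\right)\ge 1-\epsilon ,$$ where the probability is over the joint distribution of the calibration samples and the new sample.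
   Context: Each sample consists of a feature vector $\boldsymbol{X}_n$ and a realization $\boldsymbol{y}_n=(y_n^1,\dots,y_n^k)\in\mathbb{R}^k$. The prediction models below have been trained on data separate from and independent of the calibration data and the new sample, and are treated as fixed deterministic (measurable) functions of the feature vector. Let $r=\lceil (N_2+1)(1-\epsilon)\rceil$, with $r\le N_2$ so that the $r$-th order statistic below is defined. Box calibration procedure. A trained interval prediction model maps a feature vector $\boldsymbol{X}$ to lower and upper bounds $\underline{\boldsymbol{y}}(\boldsymbol{X}),\overline{\boldsymbol{y}}(\boldsymbol{X})\in\mathbb{R}^k$. For $n=1,\dots,N_2$ compute the nonconformity score $$s_n=\max_{i=1,\dots,k}\left\{\underline{y}^i(\boldsymbol{X}_n)-y_n^i,\ y_n^i-\overline{y}^i(\boldsymbol{X}_n),\ 0\right\}.$$ Sort the scores as $s^{(1)}\le\dots\le s^{(N_2)}$ and set $q=s^{(r)}$. The calibrated box uncertainty set is $$\hat{\mathcal{U}}_{\mathrm{box}}(\boldsymbol{X}_{N_2+1})=\left\{\boldsymbol{y}\in\mathbb{R}^k:\ \underline{y}^i(\boldsymbol{X}_{N_2+1})-q\le y^i\le\overline{y}^i(\boldsymbol{X}_{N_2+1})+q,\ i=1,\dots,k\right\}.$$ Ellipsoidal calibration procedure. A trained mean-variance prediction model maps $\boldsymbol{X}$ to a mean $\boldsymbol{\mu}(\boldsymbol{X})\in\mathbb{R}^k$ and variances $\sigma_i^2(\boldsymbol{X})>0$, $i=1,\dots,k$. For $n=1,\dots,N_2$ compute $$s_n=\sum_{i=1}^k\frac{(y_n^i-\mu_i(\boldsymbol{X}_n))^2}{\sigma_i^2(\boldsymbol{X}_n)}.$$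 Sort these scores as $s^{(1)}\le\dots\le s^{(N_2)}$ and set $\rho=s^{(r)}$. The calibrated ellipsoidal uncertainty set is $$\hat{\mathcal{U}}_{\mathrm{ell}}(\boldsymbol{X}_{N_2+1})=\left\{\boldsymbol{y}\in\mathbb{R}^k:\ \sum_{i=1}^k\frac{(y^i-\mu_i(\boldsymbol{X}_{N_2+1}))^2}{\sigma_i^2(\boldsymbol{X}_{N_2+1})}\le\rho\right\}.$$ *)

(* Defs.v *)
From HB Require Import structures.
From mathcomp Require Import all_boot all_order all_algebra all_fingroup.
From mathcomp Require Import all_classical all_reals all_analysis.

Set Implicit Arguments.
Unset Strict Implicit.
Unset Printing Implicit Defensive.

Import Order.TTheory GRing.Theory Num.Theory.

Local Open Scope classical_set_scope.
Local Open Scope ring_scope.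

(* The joint law, on the product sigma-algebra of [m.-tuple T], is invariant
   under every permutation of the indices. *)
Definition exchangeable (d d' : measure_display) (Omega : measurableType d)
    (T : measurableType d') (R : realType) (P : probability Omega R) (m : nat)
    (Z : 'I_m -> Omega -> T) : Prop :=
  forall (s : 'S_m) (A : set (m.-tuple T)), measurable A ->
    pushforward P (fun w => [tuple Z (s i) w | i < m]) A =
    pushforward P (fun w => [tuple Z i w | i < m]) A.

(* Points of R^k are [k.-tuple R], with its product (Borel) sigma-algebra. *)

(* For [eps < 1] the ceiling is a positive integer, so that [absz] does not
   alter it. *)
Definition conformal_rank (R : realType) (N : nat) (eps : R) : nat :=
  `|Num.ceil (N.+1%:R * (1 - eps))|%N.

(* [r] counts from 1. The value is meaningful only for [0 < r <= size s]. *)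
Definition order_statistic (R : realType) (s : seq R) (r : nat) : R :=
  nth 0 (sort <=%R s) r.-1.

Section calibration.
Context {d : measure_display} {TX : measurableType d} {R : realType}.
Context {k N : nat}.
Implicit Types (x : TX) (y : k.-tuple R) (D : N.-tuple (TX * k.-tuple R)).

Definition box_score (lo up : TX -> k.-tuple R) x y : R :=
  \big[Num.max/0]_(i < k)
    Num.max (tnth (lo x) i - tnth y i) (tnth y i - tnth (up x) i).

Definition box_threshold (lo up : TX -> k.-tuple R) (eps : R) D : R :=
  order_statistic [seq box_score lo up z.1 z.2 | z <- D]
    (conformal_rank N eps).

Definition box_set (lo up : TX -> k.-tuple R) (eps : R) D x :
    set (k.-tuple R) :=
  let q := box_threshold lo up eps D in
  [set y | forall i : 'I_k,
    tnth (lo x) i - q <= tnth y i <= tnth (up x) i + q].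

(* [var x] is the vector of variances, i.e. of the squared sigma_i. *)
Definition ell_score (mu var : TX -> k.-tuple R) x y : R :=
  \sum_(i < k) (tnth y i - tnth (mu x) i) ^+ 2 / tnth (var x) i.

Definition ell_threshold (mu var : TX -> k.-tuple R) (eps : R) D : R :=
  order_statistic [seq ell_score mu var z.1 z.2 | z <- D]
    (conformal_rank N eps).

Definition ell_set (mu var : TX -> k.-tuple R) (eps : R) D x :
    set (k.-tuple R) :=
  let rho := ell_threshold mu var eps D in
  [set y | \sum_(i < k) (tnth y i - tnth (mu x) i) ^+ 2 / tnth (var x) i
             <= rho].

End calibration.

(* The first [N] of the [N.+1] samples; the last one, at index [ord_max], is
   the new sample. *)
Definition calibration_data (Omega TX TY : Type) (N : nat)
    (X : 'I_N.+1 -> Omega -> TX) (Y : 'I_N.+1 -> Omega -> TY) (w : Omega) :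
    N.-tuple (TX * TY) :=
  [tuple (X (widen_ord (leqnSn N) n) w, Y (widen_ord (leqnSn N) n) w)
    | n < N].

(* Main.v *)
(* Among the [N + 1] scores, at least [r] have fewer than [r] scores strictly
   below them. By exchangeability this event has the same probability for each
   index, hence probability at least [r / (N + 1) >= 1 - eps] for the last one,
   where it says that the new score is at most the [r]-th order statistic of the
   calibration scores. *)
Require Import Defs.
From HB Require Import structures.
From mathcomp Require Import all_boot all_order all_algebra all_fingroup.
From mathcomp Require Import all_classical all_reals all_analysis.
From mathcomp Require Import measurable_realfun.

Set Implicit Arguments.
Unset Strict Implicit.
Unset Printing Implicit Defensive.

Import Order.TTheory GRing.Theory Num.Theory.

Local Open Scope classical_set_scope.
Local Open Scope ring_scope.

(** In the sorted list the entries below [v] form an initial segment, so the entry at position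
    [r.-1] is below [v] exactly when this segment has length at least [r]. Sorting does not change
    the count. *)
Lemma le_order_statistic (R : realType) (s : seq R) (r : nat) (v : R) :
  (0 < r <= size s)%N ->
  (v <= order_statistic s r) = (count (< v) s < r)%N.
Proof.
case: r => // r /= r_lt; rewrite /order_statistic /= ltnS.
have sorted_s : sorted <=%R (sort <=%R s) by exact: sort_le_sorted.
have count_s : count (< v) (sort <=%R s) = count (< v) s.
  by apply/seq.permP; rewrite perm_sort.
apply/idP/idP => [|count_le].
  apply: contraLR; rewrite -ltnNge -real_ltNge ?num_real// -count_s.
  exact: nth_count_lt.
by apply: nth_count_ge => //; rewrite count_s count_le size_sort.
Qed.

Lemma order_statistic_ge0 (R : realType) (s : seq R) (r : nat) :
  (forall x, x \in s -> 0 <= x) -> 0 <= order_statistic s r.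
Proof.
move=> s_ge0; rewrite /order_statistic.
(* Out of range, [nth] returns its default 0. *)
have [r_lt|?] := ltnP r.-1 (size (sort <=%R s)); last by rewrite nth_default.
by apply: s_ge0; rewrite -(mem_sort <=%R) mem_nth.
Qed.

(** Counts from 0. Tied values share the same rank, so ties among the scores need no separate
    treatment. *)
Definition strict_rank (R : realType) (m : nat) (v : 'I_m -> R) (j : 'I_m) : nat :=
  \sum_(i < m) (v i < v j)%R.

Lemma strict_rank_perm (R : realType) (m : nat) (v : 'I_m -> R) (s : 'S_m)
    (j : 'I_m) :
  strict_rank (v \o s) j = strict_rank v (s j).
Proof.
by rewrite /strict_rank [RHS](reindex_inj (@perm_inj _ s)).
Qed.

Lemma strict_rank_lt_card (R : realType) (m : nat) (v : 'I_m -> R) (r : nat) :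
  (r <= m)%N -> (r <= \sum_(j < m) (strict_rank v j < r))%N.
Proof.
move=> r_le.
have [/existsP[j0 j0P]|] := boolP [exists j, r <= strict_rank v j]%N; last first.
  rewrite negb_exists => /forallP small; rewrite (eq_bigr (fun=> 1%N)).
    by rewrite sum1_card card_ord.
  by move=> j _; rewrite ltnNge small.
(* A minimizer of [v] among the indices of large rank: all the indices strictly
   below it have small rank, and there are at least [r] of them. *)
case: (arg_minP (P := fun j => r <= strict_rank v j)%N v j0P) => j rj jmin.
apply: (leq_trans rj); apply: leq_sum => i _.
case: ltP => // vij; rewrite lt0b ltnNge; apply/negP => /jmin.
by rewrite leNgt vij.
Qed.

(** The last value is not strictly below itself, so only the first [N] values contribute. This turns
    a rank among all [N.+1] scores into a count over the calibration scores. *)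
Lemma strict_rank_ord_max (R : realType) (N : nat) (v : 'I_N.+1 -> R) :
  strict_rank v ord_max =
  count (< v ord_max) [seq v (widen_ord (leqnSn N) n) | n <- enum 'I_N].
Proof.
rewrite /strict_rank big_ord_recr /= ltxx addn0 count_map -sum1_count.
rewrite big_enum_cond /= [RHS]big_mkcond; apply: eq_bigr => i _ /=.
by case: (_ < _).
Qed.

Lemma measurable_strict_rank_lt (d : measure_display) (T : measurableType d)
    (R : realType) (m : nat) (v : 'I_m -> T -> R) (j : 'I_m) (r : nat) :
  (forall i, measurable_fun setT (v i)) ->
  measurable [set t | (strict_rank (v^~ t) j < r)%N].
Proof.
move=> mv.
(* The rank as a real-valued sum of indicators: the event becomes the preimage of an open ray. *)
pose f t : R := \sum_(i < m) (if v i t < v j t then 1 else 0).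
have mf : measurable_fun setT f.
  apply: measurable_sum => i; apply: measurable_fun_ifT => //.
  exact: measurable_fun_ltr.
suff -> : [set t | (strict_rank (v^~ t) j < r)%N] =
    setT `&` f @^-1` [set` `]-oo, r%:R[ ] by exact: mf.
have fE t : f t = (strict_rank (v^~ t) j)%:R.
  by rewrite /strict_rank natr_sum; apply: eq_bigr => i _; case: ifP.
by apply/seteqP; split => t /=; rewrite in_itv /= fE ltr_nat // => -[].
Qed.

(** The sum of the probabilities is the expected number of events that occur, and that number is at
    least [r] at every point. *)
Lemma sum_probability_ge (d : measure_display) (T : measurableType d) (R : realType)
    (P : probability T R) (m r : nat) (b : 'I_m -> T -> bool) :
  (forall j, measurable [set w | b j w]) ->
  (forall w, r <= \sum_(j < m) b j w)%N ->
  (r%:R%:E <= \sum_(j < m) P [set w | b j w])%E.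
Proof.
move=> mb r_le.
have mind j : measurable_fun setT (fun w => (\1_[set w | b j w] w : R)%:E).
  by apply/measurable_EFinP; exact: measurable_indic.
rewrite (eq_bigr (fun j => \int[P]_w (\1_[set w | b j w] w)%:E)%E); last first.
  by move=> j _; rewrite integral_indic// setIT.
rewrite -ge0_integral_sum//.
rewrite -[leLHS]mule1 -(probability_setT P) -integral_cst//.
apply: ge0_le_integral => //.
- by move=> w _; rewrite lee_fin.
- exact: emeasurable_sum.
move=> w _; rewrite sumEFin lee_fin.
rewrite (eq_bigr (fun j => (b j w)%:R)).
  by rewrite -natr_sum ler_nat.
by move=> j _; rewrite indicE mem_setE.
Qed.

(** Stated for an arbitrary measurable score, so that the box and the ellipsoid are both
    instances. *)
Lemma conformal_coverage (d d' : measure_display) (Omega : measurableType d)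
    (T : measurableType d') (R : realType) (P : probability Omega R) (N : nat)
    (Z : 'I_N.+1 -> Omega -> T) (score : T -> R) (eps : R) :
  (forall i, measurable_fun setT (Z i)) -> measurable_fun setT score ->
  exchangeable P Z -> eps < 1 -> (conformal_rank N eps <= N)%N ->
  ((1 - eps)%:E <= P [set w | (score (Z ord_max w) <= order_statistic
     [seq score (Z (widen_ord (leqnSn N) n) w) | n <- enum 'I_N]
     (conformal_rank N eps))%R])%E.
Proof.
move=> mZ mscore exchZ eps1; set r := conformal_rank N eps => rN.
have r_ge : N.+1%:R * (1 - eps) <= r%:R.
  rewrite (le_trans (ceil_ge _))// [leRHS]pmulrn ler_int.
  exact: lez_abs.
have r_gt0 : (0 < r)%N.
  by rewrite -(ltr_nat R) (lt_le_trans _ r_ge)// mulr_gt0// subr_gt0.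
pose V i w := score (Z i w).
pose E j := [set w | (strict_rank (V^~ w) j < r)%N].
have -> : [set w | (score (Z ord_max w) <= order_statistic
     [seq score (Z (widen_ord (leqnSn N) n) w) | n <- enum 'I_N] r)%R] = E ord_max.
  apply/seteqP; split => w; rewrite /E /= strict_rank_ord_max le_order_statistic//;
  by rewrite size_map size_enum_ord r_gt0.
have mV i : measurable_fun setT (V i) by exact: measurableT_comp.
have mE j : measurable (E j) by exact: measurable_strict_rank_lt.
(* The event [E ord_max] moved to the space of tuples, where exchangeability is stated. *)
pose A := [set t : N.+1.-tuple T |
  (strict_rank (fun i => score (tnth t i)) ord_max < r)%N].
have mA : measurable A.
  apply: measurable_strict_rank_lt => i.
  by apply: measurableT_comp => //; exact: measurable_tnth.
have PE j : P (E j) = P (E ord_max).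
  have preE (s : 'S_N.+1) :
      (fun w => [tuple Z (s i) w | i < N.+1]) @^-1` A = E (s ord_max).
    apply/funext => w; rewrite /A /E /= -strict_rank_perm.
    suff -> : (fun i => score (tnth [tuple Z (s i) w | i < N.+1] i)) =
              (V^~ w) \o s by [].
    by apply/funext => i; rewrite tnth_mktuple.
  (* The transposition sends the last index to [j]. The unpermuted tuple is rewritten with the
     identity permutation, so that [preE] covers both sides. *)
  have := exchZ (tperm j ord_max) A mA.
  have -> : (fun w => [tuple Z i w | i < N.+1]) =
            (fun w => [tuple Z ((1%g : 'S_N.+1) i) w | i < N.+1]).
    by apply/funext => w; apply: eq_from_tnth => i; rewrite !tnth_mktuple perm1.
  by rewrite /pushforward !preE tpermR perm1.
have := sum_probability_ge P mE (fun w => strict_rank_lt_card (V^~ w) (leqW rN)).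
rewrite (eq_bigr (fun=> P (E ord_max))) => [|j _]; last exact: PE.
have finE : P (E ord_max) \is a fin_num by exact: fin_num_measure.
rewrite -(fineK finE) sumEFin !lee_fin sumr_const card_ord -[leRHS]mulr_natl => r_le.
by rewrite -(ler_pM2l (ltr0Sn R N)) (le_trans r_ge).
Qed.

Section scores.
Context {d : measure_display} {TX : measurableType d} {R : realType} {k : nat}.
Implicit Types (x : TX) (y : k.-tuple R).

Lemma box_score_ge0 (lo up : TX -> k.-tuple R) x y : 0 <= box_score lo up x y.
Proof. by rewrite /box_score; exact: bigmax_ge_id. Qed.

(** The condition [0 <= q] accounts for the 0 inside the maximum; the other terms are the two bounds
    of each coordinate, rearranged. *)
Lemma box_score_le (lo up : TX -> k.-tuple R) x y (q : R) : 0 <= q ->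
  box_score lo up x y <= q <->
  forall i, tnth (lo x) i - q <= tnth y i <= tnth (up x) i + q.
Proof.
move=> q0; rewrite /box_score; split => [/bigmax_leP[_ le_q] i|le_q].
  have := le_q i isT; rewrite ge_max => /andP[lo_q up_q].
  by rewrite lerBlDl -lerBlDr lo_q -lerBlDl.
apply/bigmax_leP; split => // i _.
by have /andP[lo_q up_q] := le_q i; rewrite ge_max lerBlDr -lerBlDl lo_q lerBlDl.
Qed.

Lemma measurable_tnth_fst (f : {mfun TX >-> k.-tuple R}) i :
  measurable_fun setT (fun z : TX * k.-tuple R => tnth (f z.1) i).
Proof.
apply: (measurableT_comp (measurable_tnth i)).
exact: measurableT_comp.
Qed.

Lemma measurable_tnth_snd i :
  measurable_fun setT (fun z : TX * k.-tuple R => tnth z.2 i).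
Proof. exact: (measurableT_comp (measurable_tnth i)). Qed.

Lemma measurable_box_score (lo up : {mfun TX >-> k.-tuple R}) :
  measurable_fun setT (fun z : TX * k.-tuple R => box_score lo up z.1 z.2).
Proof.
rewrite /box_score.
(* Induction on the index list reduces the iterated maximum to binary ones. *)
elim: (index_enum _) => [|i s IH].
  by under eq_fun do rewrite big_nil; exact: measurable_cst.
under eq_fun do rewrite big_cons.
apply: measurable_maxr => //.
by apply: measurable_maxr;
  apply: measurable_funB;
  (exact: measurable_tnth_fst || exact: measurable_tnth_snd).
Qed.

Lemma measurable_ell_score (mu var : {mfun TX >-> k.-tuple R}) :
  (forall x i, 0 < tnth (var x) i) ->
  measurable_fun setT (fun z : TX * k.-tuple R => ell_score mu var z.1 z.2).
Proof.
move=> var_gt0; apply: measurable_sum => i.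
(* The inverse of a positive variance is its real power with exponent -1, and [powR] is
   measurable. *)
under eq_fun => z do rewrite -(powR_inv1 (ltW (var_gt0 z.1 i))).
apply: measurable_funM.
  apply: measurable_funX; apply: measurable_funB.
    exact: measurable_tnth_snd.
  exact: measurable_tnth_fst.
apply: (measurableT_comp (measurable_powR _)).
exact: measurable_tnth_fst.
Qed.

End scores.

Theorem theorem2 (R : realType)
  (d dX : measure_display) (Omega : measurableType d) (TX : measurableType dX)
  (P : probability Omega R) (k N : nat)
  (X : 'I_N.+1 -> {RV P >-> TX})
  (Y : 'I_N.+1 -> {RV P >-> k.-tuple R})
  (hexch : exchangeable P (fun n w => (X n w, Y n w)))
  (eps : R) (heps : 0 < eps < 1)
  (hrank : (conformal_rank N eps <= N)%N)
  (lo up : {mfun TX >-> k.-tuple R})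
  (mu var : {mfun TX >-> k.-tuple R})
  (hvar : forall (x : TX) (i : 'I_k), 0 < tnth (var x) i) :
  ((1 - eps)%:E <=
     P [set w | box_set lo up eps (calibration_data X Y w)
                  (X ord_max w) (Y ord_max w)])%E
  /\
  ((1 - eps)%:E <=
     P [set w | ell_set mu var eps (calibration_data X Y w)
                  (X ord_max w) (Y ord_max w)])%E.
Proof.
have /andP[_ eps1] := heps.
pose Z n w : TX * k.-tuple R := (X n w, Y n w).
have mZ n : measurable_fun setT (Z n) by exact: measurable_fun_pair.
have mbox := measurable_box_score lo up.
have mell := measurable_ell_score mu hvar.
have scoresE (f : TX * k.-tuple R -> R) w :
    [seq f z | z <- calibration_data X Y w] =
    [seq f (Z (widen_ord (leqnSn N) n) w) | n <- enum 'I_N].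
  by rewrite /calibration_data /= -map_comp.
split.
- have := conformal_coverage mZ mbox hexch eps1 hrank.
  (* The box is the sublevel set of the score at the threshold, which is nonnegative because all box
     scores are. *)
  congr (_ <= P _)%E; apply/seteqP; split=> w;
  rewrite /box_set /box_threshold /= scoresE => /box_score_le;
  apply; apply: order_statistic_ge0 => _ /mapP[n _ ->]; exact: box_score_ge0.
- have := conformal_coverage mZ mell hexch eps1 hrank.
  congr (_ <= P _)%E; apply/seteqP; split=> w;
  by rewrite /ell_set /ell_threshold /= scoresE.
Qed.
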